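(* The disconnected minimal MT-obstructions are, up to isomorphism, exactly the $28$ graphs of the family $\mathcal{F}_{disc}$.
   Context: All graphs are finite and simple. A graph $G$ is Maya-Tupi if its vertex set can be partitioned into two (possibly empty) sets $A$ and $B$ such that $\delta(G[A])\ge |A|-2$ and $\Delta(G[B])\le 1$. A minimal MT-obstruction is a graph that is not Maya-Tupi but all of whose proper induced subgraphs are Maya-Tupi. $G+H$ denotes disjoint union and $pG$ the disjoint union of $p$ copies of $G$; $P_n$, $C_n$, $K_n$ denote the path, cycle and complete graph on $n$ vertices. Let $\mathcal{J}$ be the family of the following 12 graphs: $C_4$; the diamond ($K_4$ minus an edge); $K_4$; $C_5$; the bull (a triangle with two pendant vertices attached to two distinct vertices of the triangle); $P_6$; $C_6$; and the following graphs on vertex set $\{0,1,2,3,4,5\}$: - $H$, with edges $42,43,45,50,51$; - $X_{95}$, with edges $42,43,45,50,51,01$; - $2K_3+e$ (two disjoint triangles joined by one edge), with edges $42,43,45,50,51,01,23$; - $X_{172}$, with edges $01,12,23,34,35$; - $\overline{X_{98}}$, with edges $01,12,23,34,35,45$. The family $\mathcal{F}_{disc}$ consists of the 28 graphs $3P_3$, $2P_3+K_3$, $P_3+2K_3$, $3K_3$, and $J+P_3$, $J+K_3$ for each $J\in\mathcal{J}$. *)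

(* Defs.v *)
From mathcomp Require Import all_boot.

Set Implicit Arguments.
Unset Strict Implicit.
Unset Printing Implicit Defensive.

Record sgraph := SGraph {
  vertex :> finType;
  edge : rel vertex;
  edge_sym : symmetric edge;
  edge_irr : irreflexive edge }.

Definition giso (G H : sgraph) : Prop :=
  exists2 f : G -> H, bijective f & forall x y, edge (f x) (f y) = edge x y.

Definition disconnected (G : sgraph) : Prop :=
  exists x y : G, ~~ connect (@edge G) x y.

Definition degree (G : sgraph) (x : G) : nat := #|[set y | edge x y]|.

(* The default value [#|G|] exceeds every degree, so it only matters for the
   graph with no vertex, where the minimum degree is then 0. *)
Definition min_degree (G : sgraph) : nat :=
  \big[minn/#|G|]_(x : G) degree x.

Definition max_degree (G : sgraph) : nat := \max_(x : G) degree x.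

Section Constructions.

Variables G H : sgraph.

Definition induced_edge (S : {set G}) : rel {x : G | x \in S} :=
  fun x y => edge (val x) (val y).

Lemma induced_sym S : symmetric (@induced_edge S).
Proof. by move=> x y; rewrite /induced_edge edge_sym. Qed.

Lemma induced_irr S : irreflexive (@induced_edge S).
Proof. by move=> x; rewrite /induced_edge edge_irr. Qed.

Definition induced (S : {set G}) : sgraph :=
  SGraph (@induced_sym S) (@induced_irr S).

Definition disjoint_union_edge : rel (G + H)%type := fun u v =>
  match u, v with
  | inl x, inl y => edge x y
  | inr x, inr y => edge x y
  | _, _ => false
  end.

Lemma disjoint_union_sym : symmetric disjoint_union_edge.
Proof. by case=> x [] y //=; apply: edge_sym. Qed.

Lemma disjoint_union_irr : irreflexive disjoint_union_edge.
Proof. by case=> x /=; apply: edge_irr. Qed.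

Definition disjoint_union : sgraph :=
  SGraph disjoint_union_sym disjoint_union_irr.

Definition copies_edge (p : nat) : rel ('I_p * G)%type :=
  fun u v => (u.1 == v.1) && edge u.2 v.2.

Lemma copies_sym p : symmetric (@copies_edge p).
Proof. by move=> u v; rewrite /copies_edge eq_sym edge_sym. Qed.

Lemma copies_irr p : irreflexive (@copies_edge p).
Proof. by move=> u; rewrite /copies_edge edge_irr andbF. Qed.

Definition copies (p : nat) : sgraph := SGraph (@copies_sym p) (@copies_irr p).

End Constructions.

(* For natural subtraction, [#|A| - 2 <= d] is the same as the integer
   inequality, as [d] is nonnegative. *)
Definition maya_tupi (G : sgraph) : Prop :=
  exists A B : {set G},
    [/\ A :|: B = setT, A :&: B = set0,
        #|A| - 2 <= min_degree (induced A) &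
        max_degree (induced B) <= 1].

Definition minimal_MT_obstruction (G : sgraph) : Prop :=
  ~ maya_tupi G /\
  forall S : {set G}, S \proper setT -> maya_tupi (induced S).

(* The simple graph on {0, ..., n-1} in which i and j are adjacent when they are
   distinct and related, in one order or the other, by [r]. *)
Section GraphOn.

Variables (n : nat) (r : rel nat).

Definition graph_on_edge : rel 'I_n :=
  fun i j => (i != j) && (r i j || r j i).

Lemma graph_on_sym : symmetric graph_on_edge.
Proof. by move=> i j; rewrite /graph_on_edge eq_sym orbC. Qed.

Lemma graph_on_irr : irreflexive graph_on_edge.
Proof. by move=> i; rewrite /graph_on_edge eqxx. Qed.

Definition graph_on : sgraph := SGraph graph_on_sym graph_on_irr.

End GraphOn.

Definition path_graph (n : nat) : sgraph := graph_on n (fun i j => i.+1 == j).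

Definition cycle_graph (n : nat) : sgraph :=
  graph_on n (fun i j => i.+1 %% n == j).

Definition complete_graph (n : nat) : sgraph := graph_on n (fun _ _ => true).

Definition graph_of_edges (n : nat) (s : seq (nat * nat)) : sgraph :=
  graph_on n (fun i j => (i, j) \in s).

Definition diamond : sgraph :=
  graph_of_edges 4 [:: (0, 1); (0, 2); (0, 3); (1, 2); (1, 3)].

Definition bull : sgraph :=
  graph_of_edges 5 [:: (0, 1); (1, 2); (0, 2); (0, 3); (1, 4)].

Definition H_graph : sgraph :=
  graph_of_edges 6 [:: (4, 2); (4, 3); (4, 5); (5, 0); (5, 1)].

Definition X95 : sgraph :=
  graph_of_edges 6 [:: (4, 2); (4, 3); (4, 5); (5, 0); (5, 1); (0, 1)].

Definition two_K3_plus_e : sgraph :=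
  graph_of_edges 6 [:: (4, 2); (4, 3); (4, 5); (5, 0); (5, 1); (0, 1); (2, 3)].

Definition X172 : sgraph :=
  graph_of_edges 6 [:: (0, 1); (1, 2); (2, 3); (3, 4); (3, 5)].

Definition co_X98 : sgraph :=
  graph_of_edges 6 [:: (0, 1); (1, 2); (2, 3); (3, 4); (3, 5); (4, 5)].

Definition J_family : seq sgraph :=
  [:: cycle_graph 4; diamond; complete_graph 4; cycle_graph 5; bull;
      path_graph 6; cycle_graph 6; H_graph; X95; two_K3_plus_e; X172; co_X98].

Definition F_disc_seq : seq sgraph :=
  [:: copies (path_graph 3) 3;
      disjoint_union (copies (path_graph 3) 2) (complete_graph 3);
      disjoint_union (path_graph 3) (copies (complete_graph 3) 2);
      copies (complete_graph 3) 3]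
  ++ [seq disjoint_union J L
        | J <- J_family, L <- [:: path_graph 3; complete_graph 3]].

Lemma size_F_disc_seq : size F_disc_seq = 28.
Proof. by []. Qed.

(* Tuples cannot contain finite types, for universe reasons.  By the lemma above,
   the default value of [nth] is never used. *)
Definition F_disc (i : 'I_28) : sgraph := nth (complete_graph 0) F_disc_seq i.

(* Main.v *)
(* Say that a set of vertices has a hub if deleting some vertex leaves maximum degree
   at most 1. If both sides of a disconnected graph contain a cherry (a connected
   triple), the set [A] of a Maya-Tupi partition must consist of two vertices, one on
   each side, so a partition exists iff both sides have a hub. Hence a disconnected
   minimal obstruction is a minimal hubless graph plus a [P_3] or a [K_3]. A graph is
   hubless iff its cherries have no common vertex; as cherries are 3-sets, some of
   them without common vertex already live on at most 6 vertices, and a search over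
   the graphs with at most 6 vertices finds the members of [J], [2P_3], [P_3 + K_3]
   and [2K_3]. *)

Require Import Defs.
From Corelib Require Import Setoid.
From mathcomp Require Import all_boot.

Set Implicit Arguments.
Unset Strict Implicit.
Unset Printing Implicit Defensive.

(** * Partitions into a co-matching and a matching *)

Section Thin.

Variable T : eqType.
Implicit Types (r : rel T) (S : pred T) (s : seq T).

(** Maximum degree at most 1, phrased without cardinals so that it passes to subsets and along
    injections. *)
Definition thin r S :=
  forall x y z, S x -> S y -> S z -> r x y -> r x z -> y = z.

(** The complement graph: [thin (coedge r)] on a set says that each of its vertices misses at most
    one other, the degree condition on [A]. *)
Definition coedge r : rel T := fun x y => (x != y) && ~~ r x y.

(** Testing [constant] instead of bounding a size makes repetitions in [s] harmless. *)
Definition thinb r s := all (fun x => constant [seq y <- s | r x y]) s.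

Lemma thinbP r s : reflect (thin r (mem s)) (thinb r s).
Proof.
apply: (iffP allP) => [h x y z xs ys zs rxy rxz | h x xs].
  have := h x xs; have: z \in filter (r x) s by rewrite mem_filter rxz.
  have: y \in filter (r x) s by rewrite mem_filter rxy.
  case: (filter _ _) => // u s'; rewrite !inE /= => yu zu /allP hu.
  have eq_u v : (v == u) || (v \in s') -> v = u.
    by case/orP => [/eqP // | /hu /eqP].
  by rewrite (eq_u y yu) (eq_u z zu).
case E: (filter _ _) => [|u s'] //=; apply/allP => v vs'.
have mem_u w : w \in u :: s' -> (w \in s) && r x w.
  by rewrite -E mem_filter andbC.
have /andP[us ru] := mem_u u (mem_head _ _).
have /andP[vs rv] : (v \in s) && r x v by apply: mem_u; rewrite inE vs' orbT.
by rewrite /= (h x v u).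
Qed.

Lemma thinbPn r s : ~~ thinb r s ->
  exists x y z, [/\ [&& x \in s, y \in s & z \in s], r x y, r x z & y != z].
Proof.
case/allPn => x xs; case E: (filter _ _) => [|y s'] //= /allPn[z zs' zy].
have mem_y u : u \in y :: s' -> (u \in s) && r x u by rewrite -E mem_filter andbC.
have /andP[ys ry] := mem_y y (mem_head _ _).
have /andP[zs rz] : (z \in s) && r x z by apply: mem_y; rewrite inE zs' orbT.
by exists x, y, z; rewrite xs ys zs ry rz eq_sym.
Qed.

Lemma thin_sub r S S' : {subset S <= S'} -> thin r S' -> thin r S.
Proof. by move=> sub h x y z /sub Sx /sub Sy /sub Sz; apply: h. Qed.

(** The predicate [a] cuts out the set [A] of a Maya-Tupi partition of [S]; the rest of [S] is [B].
    With predicates in place of finite sets, the vertices may be natural numbers, as the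
    computations require. *)
Definition splits r S :=
  exists a : pred T, thin (coedge r) [predI S & a] /\ thin r [predD S & a].

Lemma splits_sub r S S' : {subset S <= S'} -> splits r S' -> splits r S.
Proof.
move=> sub [a [h1 h2]]; exists a; split.
  by apply: thin_sub h1 => x; rewrite !inE => /andP[/sub -> ->].
by apply: thin_sub h2 => x; rewrite !inE => /andP[-> /sub ->].
Qed.

(* Nested conditionals rather than [&&] and [||], which call-by-value reduction
   does not short-circuit. *)
Fixpoint splitb r s A B :=
  if s isn't v :: s' then true else
  if (if thinb (coedge r) (v :: A) then splitb r s' (v :: A) B else false)
  then true
  else if thinb r (v :: B) then splitb r s' A (v :: B) else false.

Lemma splitb_sound r s A B :
    splitb r s A B -> thinb (coedge r) A -> thinb r B ->
  exists A' B', [/\ thinb (coedge r) A', thinb r B',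
    {subset A <= A'}, {subset B <= B'} & {subset s <= A' ++ B'}].
Proof.
elim: s A B => [|v s IH] A B /=; first by move=> _ hA hB; exists A, B; split.
case: ifP => [|_].
  case: ifP => // hA' /IH{}IH _ _ hB; have [A' [B' [hA hB' sA sB ss]]] := IH hA' hB.
  exists A', B'; split=> // u; first by move=> uA; apply: sA; rewrite inE uA orbT.
  rewrite inE => /orP[/eqP -> | /ss //].
  by rewrite mem_cat sA ?mem_head.
case: ifP => // hB' /IH{}IH hA _; have [A' [B' [hA' hB sA sB ss]]] := IH hA hB'.
exists A', B'; split=> // u; first by move=> uB; apply: sB; rewrite inE uB orbT.
rewrite inE => /orP[/eqP -> | /ss //].
by rewrite mem_cat sB ?mem_head ?orbT.
Qed.

(** Following [a] is a branch of the search that cannot fail, as its accumulators stay inside the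
    two thin sets. *)
Lemma splitb_complete r s A B (S a : pred T) :
    thin (coedge r) [predI S & a] -> thin r [predD S & a] ->
    all S s -> all [predI S & a] A -> all [predD S & a] B ->
  splitb r s A B.
Proof.
move=> hA hB; elim: s A B => //= v s IH A B /andP[Sv Ss] sA sB.
have thinA L : all [predI S & a] L -> thinb (coedge r) L.
  by move=> /allP sL; apply/thinbP; apply: thin_sub hA.
have thinB L : all [predD S & a] L -> thinb r L.
  by move=> /allP sL; apply/thinbP; apply: thin_sub hB.
have [av|av] := boolP (a v).
  have sA' : all [predI S & a] (v :: A) by apply/andP; split=> //; apply/andP.
  by rewrite thinA // IH.
case: ifP => // _; have sB' : all [predD S & a] (v :: B).
  by apply/andP; split=> //; apply/andP.
by rewrite thinB // IH.
Qed.

Lemma splitbP r s : reflect (splits r (mem s)) (splitb r s [::] [::]).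
Proof.
apply: (iffP idP) => [/splitb_sound[] // A [B [/thinbP hA /thinbP hB _ _ sAB]] |].
  exists (mem A); split; first by apply: thin_sub hA => x /andP[].
  apply: thin_sub hB => x /andP[/= xA /sAB].
  by rewrite mem_cat (negbTE xA).
by case=> a [hA hB]; apply: splitb_complete hA hB _ _ _ => //; apply/allP.
Qed.

End Thin.

(** Partitions pull back along embeddings: the Maya-Tupi property is hereditary. *)
Lemma splits_inj (T U : eqType) (f : T -> U) (e : rel T) (e' : rel U) (S : pred U) :
    injective f -> (forall x y, e' (f x) (f y) = e x y) ->
  splits e' S -> splits e (preim f S).
Proof.
move=> f_inj fE [a [hA hB]]; exists (preim f a); split=> x y z Sx Sy Sz.
  rewrite /coedge -!(inj_eq f_inj) -!fE => exy exz; apply: f_inj.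
  exact: hA Sx Sy Sz exy exz.
by rewrite -!fE => exy exz; apply: f_inj; apply: hB Sx Sy Sz exy exz.
Qed.

(** Serves both [induced], which lives on a sigma type, and [graph_of], which lives on ordinals. *)
Lemma splits_val (U : eqType) (P : pred U) (sT : subEqType P) (e : rel U) :
  splits e P <-> splits (fun x y : sT => e (val x) (val y)) predT.
Proof.
split=> [h | [a [hA hB]]].
  have := @splits_inj _ _ (val : sT -> U) (fun x y => e (val x) (val y)) e P
    val_inj (fun _ _ => erefl) h.
  by apply: splits_sub => x _; apply: (valP x).
(* The default [false] concerns only points outside [P], which are never consulted. *)
pose b x := if insub x is Some u then a (u : sT) else false.
have bE (u : sT) : b (val u) = a u by rewrite /b valK.
have inA (u : sT) : b (val u) -> [predI predT & a] u by rewrite bE.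
have inB (u : sT) : ~~ b (val u) -> [predD predT & a] u.
  by rewrite bE => au; apply/andP.
have lift x : P x -> exists u : sT, val u = x.
  by move=> Px; exists (Sub x Px); rewrite SubK.
exists b; split=> x y z /andP[hx1 hx2] /andP[hy1 hy2] /andP[hz1 hz2].
  move: (lift x hx1) (lift y hy1) (lift z hz1) hx2 hy2 hz2.
  move=> [u <-] [v <-] [w <-] bu bv bw.
  rewrite /coedge !(inj_eq val_inj) => uv uw; congr val.
  exact: hA (inA u bu) (inA v bv) (inA w bw) uv uw.
move: (lift x hx2) (lift y hy2) (lift z hz2) hx1 hy1 hz1.
move=> [u <-] [v <-] [w <-] bu bv bw.
by move=> uv uw; congr val; apply: hB (inB u bu) (inB v bv) (inB w bw) uv uw.
Qed.

(** * The Maya-Tupi property in terms of [splits] *)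

Lemma leq_bigmin (I : finType) (F : I -> nat) m n :
  m <= \big[minn/n]_i F i <-> m <= n /\ forall i, m <= F i.
Proof.
have -> : (m <= \big[minn/n]_i F i) =
    (m <= n) && all (fun i => m <= F i) (index_enum I).
  elim: (index_enum I) => [|i s IH]; first by rewrite big_nil andbT.
  by rewrite big_cons leq_min IH andbCA.
split=> [/andP[-> /allP h] | [-> h]]; last exact/allP.
by split=> // i; apply: h; apply: mem_index_enum.
Qed.

Lemma edge_neq (G : sgraph) (x y : G) : edge x y -> x != y.
Proof. by apply: contraTneq => ->; rewrite edge_irr. Qed.

Lemma degree_coedge (G : sgraph) (x : G) :
  degree x + #|[set y | coedge (@edge G) x y]| = #|G|.-1.
Proof.
rewrite /degree -cardsUI.
have -> : [set y | edge x y] :&: [set y | coedge (@edge G) x y] = set0.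
  by apply/setP => y; rewrite !inE /coedge; case: edge; rewrite ?andbF.
rewrite cards0 addn0 -(cardC1 x); apply: eq_card => y.
rewrite !inE /coedge [y == x]eq_sym; case: eqP => [<-|] /=.
  by rewrite edge_irr.
by case: edge.
Qed.

Lemma thin_card (T : finType) (r : rel T) :
  thin r predT <-> forall x, #|[set y | r x y]| <= 1.
Proof.
split=> [h x | h x y z _ _ _ rxy rxz].
  by apply/card_le1_eqP => y z; rewrite !inE => ry rz; apply: h rz ry.
by apply/esym/(card_le1_eqP (h x)); rewrite inE.
Qed.

Lemma max_degree_le1 (G : sgraph) : max_degree G <= 1 <-> thin (@edge G) predT.
Proof.
rewrite thin_card /max_degree; split=> [/bigmax_leqP h x | h]; first exact: h.
by apply/bigmax_leqP => x _; apply: h.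
Qed.

Lemma min_degree_ge (G : sgraph) :
  #|G| - 2 <= min_degree G <-> thin (coedge (@edge G)) predT.
Proof.
rewrite thin_card /min_degree leq_bigmin leq_subr.
(* The neighbours and the non-neighbours of [x] number [#|G| - 1] together; the vertex [x] itself
   ensures that this subtraction is not truncated. *)
have E (x : G) : (#|G| - 2 <= degree x) = (#|[set y | coedge (@edge G) x y]| <= 1).
  have := degree_coedge x; have : 0 < #|G| by apply/card_gt0P; exists x.
  case: #|G| => // n _ /= <-.
  by rewrite subSS leq_subLR addnC leq_add2r.
by split=> [[_ h] x | h]; [rewrite -E | split=> // x; rewrite E].
Qed.

Lemma thin_induced (G : sgraph) (A : {set G}) (r : rel G) :
  thin (fun x y : induced A => r (val x) (val y)) predT <-> thin r (mem A).
Proof.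
split=> h x y z; last first.
  by move=> _ _ _ rxy rxz; apply: val_inj; apply: h rxy rxz; apply: valP.
move=> xA yA zA rxy rxz.
by have [] := h (exist _ x xA) (exist _ y yA) (exist _ z zA) isT isT isT rxy rxz.
Qed.

Lemma maya_tupiP (G : sgraph) : maya_tupi G <-> splits (@edge G) predT.
Proof.
have thinA (A : {set G}) :
    #|A| - 2 <= min_degree (induced A) <-> thin (coedge (@edge G)) (mem A).
  rewrite -thin_induced -[#|A|]/#|mem A| -card_sig min_degree_ge.
  by split=> h x y z Sx Sy Sz; apply: h.
have thinB (A : {set G}) : max_degree (induced A) <= 1 <-> thin (@edge G) (mem A).
  by rewrite max_degree_le1 thin_induced.
split=> [[A [B [AB _ /thinA hA /thinB hB]]] | [a [hA hB]]].
  exists (mem A); split; first exact: thin_sub hA.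
  apply: thin_sub hB => x; rewrite !inE andbT => xA.
  by have := in_setT x; rewrite -AB inE (negbTE xA).
exists [set x | a x], [set x | ~~ a x]; split.
- by apply/setP => x; rewrite !inE orbN.
- by apply/setP => x; rewrite !inE andbN.
- by apply/thinA; apply: thin_sub hA => x; rewrite !inE.
- by apply/thinB; apply: thin_sub hB => x; rewrite !inE andbT.
Qed.

Lemma maya_tupi_induced (G : sgraph) (S : {set G}) :
  maya_tupi (induced S) <-> splits (@edge G) (mem S).
Proof. by rewrite maya_tupiP -(@splits_val _ _ (induced S)). Qed.

(** By heredity it suffices to delete single vertices: a proper subset misses some [x]. *)
Lemma minimal_MT_obstructionP (G : sgraph) :
  minimal_MT_obstruction G <->
  ~ splits (@edge G) predT /\ forall x, splits (@edge G) (predC1 x).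
Proof.
rewrite /minimal_MT_obstruction maya_tupiP; split=> -[hG hS]; split=> //.
  move=> x; have /maya_tupi_induced : maya_tupi (induced [set~ x]).
    by apply: hS; rewrite properT; apply/eqP => /setP/(_ x); rewrite !inE eqxx.
  by apply: splits_sub => y; rewrite !inE.
move=> S; rewrite properT => SnT; apply/maya_tupi_induced.
have [x xS] : exists x, x \notin S.
  apply/existsP; rewrite -negb_forall; apply: contraNN SnT => /forallP h.
  by apply/eqP/setP => y; rewrite h inE.
by apply: splits_sub (hS x) => y yS; rewrite !inE; apply: contraNneq xS => <-.
Qed.

(** * Embeddings and isomorphisms *)

Definition embeds_in (H G : sgraph) (S : pred G) :=
  exists f : H -> G, [/\ injective f, forall x y, edge (f x) (f y) = edge x y
    & forall x, S (f x)].

Definition embeds H G := @embeds_in H G predT.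

Lemma embeds_in_sub (H G : sgraph) (S S' : pred G) :
  {subset S <= S'} -> embeds_in H S -> embeds_in H S'.
Proof.
by move=> sub [f [fI fE fS]]; exists f; split=> // x; apply: sub; apply: fS.
Qed.

Lemma embeds_trans (G H K : sgraph) : embeds G H -> embeds H K -> embeds G K.
Proof.
move=> [f [fI fE _]] [g [gI gE _]]; exists (g \o f).
by split=> //= [|x y]; [apply: inj_comp | rewrite gE fE].
Qed.

Lemma giso_refl G : giso G G.
Proof. by exists id => //; exists id. Qed.

Lemma giso_sym G H : giso G H -> giso H G.
Proof.
move=> [f [g fK gK] fE]; exists g; first by exists f.
by move=> x y; rewrite -fE !gK.
Qed.

Lemma giso_trans G H K : giso G H -> giso H K -> giso G K.
Proof.
move=> [f fb fE] [g gb gE]; exists (g \o f); first exact: bij_comp.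
by move=> x y; rewrite /= gE fE.
Qed.

Lemma giso_embeds G H : giso G H -> embeds G H.
Proof. by case=> f /bij_inj fI fE; exists f. Qed.

Lemma maya_tupi_embeds H G : embeds H G -> maya_tupi G -> maya_tupi H.
Proof.
by move=> [f [fI fE _]] /maya_tupiP h; apply/maya_tupiP/(splits_inj fI fE h).
Qed.

Lemma minimal_MT_obstruction_giso G H :
  giso G H -> minimal_MT_obstruction H -> minimal_MT_obstruction G.
Proof.
move=> GH /minimal_MT_obstructionP[/maya_tupiP nH mH]; apply/minimal_MT_obstructionP.
split=> [/maya_tupiP /(maya_tupi_embeds (giso_embeds (giso_sym GH))) // | x].
case: GH => f /bij_inj fI fE; have := splits_inj fI fE (mH (f x)).
by apply: splits_sub => y; rewrite !inE (inj_eq fI).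
Qed.

(** If the embedding missed a vertex [y], then [H] would lie in [G] minus [y], which splits, and [H]
    would be Maya-Tupi. *)
Lemma embeds_minimal_giso H G :
  ~ maya_tupi H -> minimal_MT_obstruction G -> embeds H G -> giso G H.
Proof.
move=> nH /minimal_MT_obstructionP[_ mG] [f [fI fE _]]; apply: giso_sym.
suff f_surj y : y \in codom f.
  by exists f => //; exists (fun y => iinv (f_surj y)) => x; rewrite (iinv_f, f_iinv).
apply/negPn/negP => yf; apply: nH; apply/maya_tupiP.
apply: splits_sub (splits_inj fI fE (mG y)) => x _; rewrite !inE /=.
by apply: contraNneq yf => <-; apply: codom_f.
Qed.

(** Replaces connectivity by a cut that no edge crosses; the component of a vertex provides one. *)
Lemma disconnectedP (G : sgraph) :
  disconnected G <->
  exists C : pred G, (forall x y, edge x y -> C x = C y) /\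
    exists x y, C x /\ ~~ C y.
Proof.
split=> [[x [y nxy]] | [C [hC [x [y [Cx nCy]]]]]].
  exists (connect (@edge G) x); split; last by exists x, y.
  move=> u v uv; apply: same_connect_r (connect1 uv) _.
  exact/sym_connect_sym/edge_sym.
exists x, y; apply: contra nCy => /(closed_connect (a := C) hC).
by rewrite unfold_in Cx unfold_in => <-.
Qed.

Lemma disconnected_giso G H : giso G H -> disconnected H -> disconnected G.
Proof.
move=> [f [g fK gK] fE] /disconnectedP[C [hC [x [y [Cx Cy]]]]].
apply/disconnectedP; exists (preim f C); split=> [u v uv | ].
  by apply: hC; rewrite fE.
by exists (g x), (g y); rewrite /= !gK.
Qed.

(** * Graphs on initial segments of the natural numbers *)

(** Vertices are natural numbers so that the finite checks can be run by [vm_compute]. *)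
Definition code := (nat * rel nat)%type.

Definition adj (c : code) : rel nat := fun i j => (i != j) && (c.2 i j || c.2 j i).

Definition graph_of (c : code) : sgraph := graph_on c.1 c.2.

Lemma adj_sym c : symmetric (adj c).
Proof. by move=> i j; rewrite /adj eq_sym orbC. Qed.

Lemma graph_ofE c (i j : graph_of c) : edge i j = adj c (val i) (val j).
Proof. by []. Qed.

Definition path_code n : code := (n, fun i j => i.+1 == j).
Definition cycle_code n : code := (n, fun i j => i.+1 %% n == j).
Definition complete_code n : code := (n, fun _ _ => true).
Definition edges_code n (s : seq (nat * nat)) : code := (n, fun i j => (i, j) \in s).

(** The test [c.1 <= j] guards the truncated subtraction, which sends every vertex of [c] to vertex
    0 of [d]. *)
Definition sum_code (c d : code) : code :=
  (c.1 + d.1, fun i j => if i < c.1 then (j < c.1) && c.2 i j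
                         else (c.1 <= j) && d.2 (i - c.1) (j - c.1)).

(** Vertex [v] of copy [u] has number [u * c.1 + v], which division by [c.1] decodes. *)
Definition copies_code (c : code) (p : nat) : code :=
  (p * c.1, fun i j => (i %/ c.1 == j %/ c.1) && c.2 (i %% c.1) (j %% c.1)).

Lemma adj_sum c d i j : adj (sum_code c d) i j =
  if i < c.1 then (j < c.1) && adj c i j
  else (c.1 <= j) && adj d (i - c.1) (j - c.1).
Proof.
rewrite /adj /= !(ltnNge _ c.1); case: (leqP c.1 i) => hi; case: (leqP c.1 j) => hj;
  rewrite ?andbF //=.
by congr (~~ _ && _); rewrite -(eqn_add2r c.1 (i - c.1)) !subnK.
Qed.

Lemma giso_bij_card (G H : sgraph) (f : G -> H) :
    injective f -> #|H| <= #|G| -> (forall x y, edge (f x) (f y) = edge x y) ->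
  giso G H.
Proof. by move=> fI GH fE; exists f => //; apply: inj_card_bij. Qed.

Lemma giso_sum c d :
  giso (disjoint_union (graph_of c) (graph_of d)) (graph_of (sum_code c d)).
Proof.
apply: (@giso_bij_card (disjoint_union (graph_of c) (graph_of d))
  (graph_of (sum_code c d)) (@unsplit c.1 d.1)).
- exact: can_inj (@unsplitK c.1 d.1).
- by rewrite card_sum !card_ord.
move=> x y; rewrite graph_ofE adj_sum.
case: x y => i [] j /=.
- by rewrite !ltn_ord.
- by rewrite ltn_ord ltnNge leq_addr.
- by rewrite ltnNge leq_addr /= leqNgt ltn_ord.
by rewrite ltnNge !leq_addr !addKn.
Qed.

Lemma giso_copies c p : giso (copies (graph_of c) p) (graph_of (copies_code c p)).
Proof.
have lt_f (u : copies (graph_of c) p) : u.1 * c.1 + u.2 < p * c.1.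
  apply: (@leq_trans (u.1.+1 * c.1)); last by rewrite leq_mul2r ltn_ord orbT.
  by rewrite mulSn addnC ltn_add2r ltn_ord.
have c_gt0 (v : graph_of c) : 0 < c.1 by apply: leq_ltn_trans (ltn_ord v).
have divf i (v : graph_of c) : (i * c.1 + v) %/ c.1 = i.
  by rewrite divnMDl ?(c_gt0 v) // divn_small ?addn0.
have modf i (v : graph_of c) : (i * c.1 + v) %% c.1 = v.
  by rewrite modnMDl modn_small.
apply: (@giso_bij_card (copies (graph_of c) p) (graph_of (copies_code c p))
  (fun u => Ordinal (lt_f u))).
- move=> [i v] [j w] [/= E]; congr (_, _); apply: val_inj => /=.
    by rewrite -(divf i v) E divf.
  by rewrite -(modf i v) E modf.
- by rewrite card_prod !card_ord.
move=> [i v] [j w]; rewrite graph_ofE /adj /= !divf !modf /copies_edge /=.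
rewrite [(j : nat) == i]eq_sym -andb_orr andbCA -[i == j]val_eqE /=.
by case: eqP => //= ->; rewrite /graph_on_edge eqn_add2l.
Qed.

Definition P3 := path_code 3.
Definition K3 := complete_code 3.

Definition J_codes : seq code :=
  [:: cycle_code 4;
      edges_code 4 [:: (0, 1); (0, 2); (0, 3); (1, 2); (1, 3)];
      complete_code 4; cycle_code 5;
      edges_code 5 [:: (0, 1); (1, 2); (0, 2); (0, 3); (1, 4)];
      path_code 6; cycle_code 6;
      edges_code 6 [:: (4, 2); (4, 3); (4, 5); (5, 0); (5, 1)];
      edges_code 6 [:: (4, 2); (4, 3); (4, 5); (5, 0); (5, 1); (0, 1)];
      edges_code 6 [:: (4, 2); (4, 3); (4, 5); (5, 0); (5, 1); (0, 1); (2, 3)];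
      edges_code 6 [:: (0, 1); (1, 2); (2, 3); (3, 4); (3, 5)];
      edges_code 6 [:: (0, 1); (1, 2); (2, 3); (3, 4); (3, 5); (4, 5)]].

Definition F_codes : seq code :=
  [:: copies_code P3 3; sum_code (copies_code P3 2) K3;
      sum_code P3 (copies_code K3 2); copies_code K3 3]
  ++ [seq sum_code J L | J <- J_codes, L <- [:: P3; K3]].

Lemma giso_disjoint_union G G' H H' :
  giso G G' -> giso H H' -> giso (disjoint_union G H) (disjoint_union G' H').
Proof.
move=> [f [f' fK f'K] fE] [g [g' gK g'K] gE].
exists (fun u => match u with inl x => inl (f x) | inr y => inr (g y) end).
  exists (fun u => match u with inl x => inl (f' x) | inr y => inr (g' y) end).
    by case=> x; rewrite ?fK ?gK.
  by case=> x; rewrite ?f'K ?g'K.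
by case=> x [] y //=; rewrite ?fE ?gE.
Qed.

Lemma F_disc_code (i : 'I_28) :
  giso (F_disc i) (graph_of (nth (complete_code 0) F_codes i)).
Proof.
case: i => i lti; do 28 try destruct i as [|i]; rewrite // /F_disc /=;
  try match goal with
  | |- giso _ (graph_of (sum_code ?c ?d)) => exact: (giso_sum c d)
  end.
(* The 24 sums of a graph of [J_codes] with [P3] or [K3] are settled; the four graphs built from
   several copies remain. *)
- exact: (giso_copies P3 3).
- apply: giso_trans (giso_sum (copies_code P3 2) K3).
  exact: giso_disjoint_union (giso_copies P3 2) (giso_refl _).
- apply: giso_trans (giso_sum P3 (copies_code K3 2)).
  exact: giso_disjoint_union (giso_refl _) (giso_copies K3 2).
exact: (giso_copies K3 3).
Qed.

(** * An isomorphism invariant *)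

Section EdgeWeight.

Variables (T : eqType) (r : rel T).

Definition deg s x := count (r x) s.

Definition codeg s x y := count (predI (r x) (r y)) s.

(* An isomorphism invariant, found by trial, that tells the 28 graphs apart. *)
Definition edge_weight s :=
  sumn [seq sumn [seq (deg s x * deg s y + codeg s x y) ^ 2 | y <- s & r x y]
       | x <- s].

Lemma edge_weight_perm s s' : perm_eq s s' -> edge_weight s = edge_weight s'.
Proof.
move=> ss'; rewrite /edge_weight.
have eq_deg x : deg s x = deg s' x by apply: (permP ss').
have eq_codeg x y : codeg s x y = codeg s' x y by apply: (permP ss').
rewrite (perm_sumn (perm_map _ ss')); congr sumn; apply: eq_map => x.
rewrite (perm_sumn (perm_map _ (perm_filter _ ss'))); congr sumn.
by apply: eq_map => y; rewrite !eq_deg eq_codeg.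
Qed.

End EdgeWeight.

Lemma edge_weight_map (T U : eqType) (f : T -> U) (r : rel T) (r' : rel U) s :
    (forall x y, r' (f x) (f y) = r x y) ->
  edge_weight r' (map f s) = edge_weight r s.
Proof.
move=> rE; have eq_deg x : deg r' (map f s) (f x) = deg r s x.
  by rewrite /deg count_map; apply: eq_count => y; apply: rE.
have eq_codeg x y : codeg r' (map f s) (f x) (f y) = codeg r s x y.
  by rewrite /codeg count_map; apply: eq_count => z; rewrite /= !rE.
rewrite /edge_weight -map_comp; congr sumn; apply: eq_map => x /=.
rewrite filter_map -map_comp; congr sumn.
rewrite (eq_filter (a2 := r x)) => [|y]; last exact: rE.
by apply: eq_map => y; rewrite /= !eq_deg eq_codeg.
Qed.

Lemma edge_weight_giso (G H : sgraph) :
  giso G H -> edge_weight (@edge G) (enum G) = edge_weight (@edge H) (enum H).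
Proof.
move=> [f f_bij fE]; rewrite -(edge_weight_map _ fE); apply: edge_weight_perm.
have fI := bij_inj f_bij; apply: uniq_perm; rewrite ?(map_inj_uniq fI) ?enum_uniq //.
move=> y; rewrite mem_enum inE; case: f_bij => g _ gK.
by rewrite -[y]gK map_f ?mem_enum.
Qed.

Definition code_weight c := edge_weight (adj c) (iota 0 c.1).

Lemma edge_weight_code c :
  edge_weight (@edge (graph_of c)) (enum (graph_of c)) = code_weight c.
Proof. by rewrite /code_weight -val_enum_ord; apply/esym/edge_weight_map. Qed.

Definition F_weights := map code_weight F_codes.

Lemma F_weights_uniq : uniq F_weights.
Proof. by vm_compute. Qed.

(** Isomorphic graphs have equal weights, and the 28 weights are distinct. *)
Lemma F_disc_inj (i j : 'I_28) : giso (F_disc i) (F_disc j) -> i = j.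
Proof.
move=> ij; apply: val_inj; apply/eqP.
rewrite -(nth_uniq 0 (s := F_weights) (ltn_ord i) (ltn_ord j) F_weights_uniq).
have lt_size (k : 'I_28) : k < size F_codes by apply: ltn_ord.
rewrite !(nth_map (complete_code 0)) ?lt_size // -!edge_weight_code.
apply/eqP/edge_weight_giso.
exact: giso_trans (giso_sym (F_disc_code i)) (giso_trans ij (F_disc_code j)).
Qed.

(** * The 28 graphs are disconnected minimal obstructions, by computation *)

Lemma maya_tupi_code c : maya_tupi (graph_of c) <-> splits (adj c) (gtn c.1).
Proof. by rewrite maya_tupiP (@splits_val _ (gtn c.1) 'I_c.1). Qed.

Definition obstructionb c :=
  ~~ splitb (adj c) (iota 0 c.1) [::] [::] &&
  all (fun v => splitb (adj c) (rem v (iota 0 c.1)) [::] [::]) (iota 0 c.1).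

Lemma val_in_iota n (i : 'I_n) : val i \in iota 0 n.
Proof. by rewrite mem_iota ltn_ord. Qed.

Lemma obstructionbP c : obstructionb c -> minimal_MT_obstruction (graph_of c).
Proof.
move=> /andP[/splitbP nsplit /allP vsplit].
apply/minimal_MT_obstructionP; split=> [/maya_tupiP/maya_tupi_code h | v].
  by apply: nsplit; apply: splits_sub h => i; rewrite unfold_in mem_iota.
have /vsplit/splitbP h := val_in_iota v.
apply: splits_sub (splits_inj val_inj (graph_ofE (c := c)) h) => u.
by rewrite !inE /= mem_rem_uniq ?iota_uniq // inE mem_iota add0n (ltn_ord u) !andbT.
Qed.

Lemma F_codes_obstruction : all obstructionb F_codes.
Proof. by vm_compute. Qed.

Definition disconnectedb k c :=
  let s := iota 0 c.1 in
  [&& 0 < k, k < c.1 &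
      all (fun i => all (fun j => adj c i j ==> ((i < k) == (j < k))) s) s].

Lemma disconnectedbP k c : disconnectedb k c -> disconnected (graph_of c).
Proof.
move=> /and3P[k_gt0 kc /allP h]; apply/disconnectedP.
exists (fun i : 'I_c.1 => i < k); split=> [i j ij | ].
  have /allP/(_ _ (val_in_iota j)) := h _ (val_in_iota i).
  by rewrite -graph_ofE ij => /eqP.
by exists (Ordinal (ltn_trans k_gt0 kc)), (Ordinal kc); rewrite /= -leqNgt.
Qed.

(** Every code of the list has a [P3] or a [K3] on its last three vertices, so no edge crosses the
    cut at [c.1 - 3]. *)
Lemma F_codes_disconnected : all (fun c => disconnectedb (c.1 - 3) c) F_codes.
Proof. by vm_compute. Qed.

(** * Search for an embedded graph *)

(** A conditional in place of [||], so that call-by-value reduction stops at the first success. *)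
Fixpoint has_lazily T (p : pred T) s :=
  if s isn't x :: s' then false else if p x then true else has_lazily p s'.

Lemma has_lazilyE T (p : pred T) s : has_lazily p s = has p s.
Proof. by elim: s => //= x s ->; case: (p x). Qed.

(** The list [t] holds the images of vertices [i], [i + 1] and so on; [row] prescribes their
    adjacency to the candidate image [v] of a new vertex. *)
Fixpoint compatible (e : rel nat) (row : nat -> bool) v i t :=
  if t isn't u :: t' then true else
  if u == v then false else
  if e u v == row i then compatible e row v i.+1 t' else false.

(** Backtracking: [t] holds the images of the first vertices of the pattern [r], and [k] vertices
    remain to be placed in [W]. *)
Fixpoint embedb_from (e : rel nat) W (r : rel nat) k t :=
  if k isn't k'.+1 then true else
  has_lazily (fun v => if compatible e (fun i => r i (size t)) v 0 t
                       then embedb_from e W r k' (rcons t v) else false) W.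

Definition partial_embedding (e : rel nat) (W : seq nat) (r : rel nat) t :=
  {subset t <= W} /\ forall i j, i < j < size t ->
    nth 0 t i != nth 0 t j /\ e (nth 0 t i) (nth 0 t j) = r i j.

Lemma compatibleP e row v k t : compatible e row v k t ->
  forall i, i < size t -> nth 0 t i != v /\ e (nth 0 t i) v = row (k + i).
Proof.
elim: t k => //= u t IH k; case: eqP => // uv; case: eqP => // euv /IH{}IH [|i] lt_i.
  by rewrite addn0; split=> //; apply/eqP.
by rewrite addnS -addSn; apply: IH.
Qed.

Lemma embedb_fromP e W r k t :
    partial_embedding e W r t -> embedb_from e W r k t ->
  exists2 t', size t' = k + size t & partial_embedding e W r t'.
Proof.
elim: k t => [|k IH] t t_emb /=; first by exists t.
rewrite has_lazilyE => /hasP[v vW]; case: ifP => // /compatibleP v_ok.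
move=> /IH[|t' t'_size t'_emb]; last first.
  by exists t'; rewrite // t'_size size_rcons addnS.
case: t_emb => tW t_emb; split=> [u | i j].
  by rewrite mem_rcons inE => /orP[/eqP -> | /tW].
rewrite size_rcons => /andP[ij]; rewrite ltnS leq_eqVlt => /orP[/eqP Ej | jt].
  (* Here [j] is the index of the new image [v], to which compatibility applies. *)
  by rewrite !nth_rcons -Ej ij ltnn eqxx Ej; apply: v_ok; rewrite -Ej.
by rewrite !nth_rcons jt (ltn_trans ij jt); apply: t_emb; rewrite ij.
Qed.

Definition embedb e n r k := embedb_from e (iota 0 n) r k [::].

Lemma embeds_in_seq c (G : sgraph) (x0 : G) t (S : pred G) :
    size t = c.1 -> {subset t <= S} ->
    (forall i j, i < j < c.1 -> nth x0 t i != nth x0 t j /\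
       edge (nth x0 t i) (nth x0 t j) = adj c i j) ->
  @embeds_in (graph_of c) G S.
Proof.
move=> t_size tS t_emb; exists (fun i : graph_of c => nth x0 t i); split.
- move=> i j E; apply: val_inj; apply/eqP; case: ltngtP => // ij; exfalso.
    by have [] := t_emb i j; rewrite ?ij ?ltn_ord // E eqxx.
  by have [] := t_emb j i; rewrite ?ij ?ltn_ord // E eqxx.
- move=> i j; rewrite graph_ofE /=; case: (ltngtP i j) => [ij | ij | /val_inj ->].
  + by case: (t_emb i j); rewrite ?ij ?ltn_ord.
  + by rewrite edge_sym adj_sym; case: (t_emb j i); rewrite ?ij ?ltn_ord.
  + by rewrite edge_irr /adj eqxx.
by move=> i; apply: tS; rewrite mem_nth // t_size ltn_ord.
Qed.

(** The search runs on positions in [s]. Agreement of [e] and [r] with the graphs is asked only for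
    indices in range, which is all that a finite table provides. *)
Lemma embedb_embeds_in (G : sgraph) (x0 : G) s e c (r : rel nat) :
    uniq s ->
    {in iota 0 (size s) &, forall i j, e i j = edge (nth x0 s i) (nth x0 s j)} ->
    {in iota 0 c.1 &, r =2 adj c} ->
    embedb e (size s) r c.1 ->
  @embeds_in (graph_of c) G (mem s).
Proof.
move=> s_uniq eE rE /embedb_fromP[].
  by split=> // i j; rewrite ltn0 andbF.
rewrite addn0 => t t_size [tW t_emb].
have t_in i : i < c.1 -> nth 0 t i \in iota 0 (size s).
  by rewrite -t_size => /(mem_nth 0)/tW.
have lt_t i : i < c.1 -> nth 0 t i < size s by move=> /t_in; rewrite mem_iota.
apply: (@embeds_in_seq _ _ x0 [seq nth x0 s i | i <- t]); first by rewrite size_map.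
  by move=> _ /mapP[i it ->]; apply: mem_nth; have := tW i it; rewrite mem_iota.
move=> i j /andP[ij jc]; have ic := ltn_trans ij jc.
rewrite !(nth_map 0) ?t_size // nth_uniq ?lt_t // -eE ?t_in //.
by have [] := t_emb i j; rewrite ?t_size ?ij // => -> ->; rewrite rE // mem_iota.
Qed.

(* Graphs are enumerated as lower triangular tables: row [i] has length [i]. *)
Definition table_adj (m : seq (seq bool)) : rel nat := fun i j =>
  if j < i then nth false (nth [::] m i) j else nth false (nth [::] m j) i.

Definition tabulate (r : rel nat) n := mkseq (fun i => mkseq (r i) i) n.

Lemma table_adj_tabulate (r : rel nat) n :
    symmetric r -> irreflexive r ->
  {in iota 0 n &, table_adj (tabulate r n) =2 r}.
Proof.
move=> r_sym r_irr i j; rewrite !mem_iota /= !add0n => lt_i lt_j.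
rewrite /table_adj (nth_mkseq _ _ lt_i) (nth_mkseq _ _ lt_j).
case: ltngtP => [ji|ij|->].
- by rewrite nth_mkseq.
- by rewrite nth_mkseq // r_sym.
by rewrite nth_default ?size_mkseq // r_irr.
Qed.

(** * Exhaustive search among the graphs with at most 6 vertices *)

Definition hubless_codes : seq code :=
  J_codes ++ [:: copies_code P3 2; sum_code P3 K3; copies_code K3 2].

Definition hubb e n := has (fun v => thinb e (rem v (iota 0 n))) (iota 0 n).

(** Adjacencies are tabulated so that each query of the search is a lookup. *)
Definition tables := [seq (tabulate (adj c) c.1, c.1) | c <- hubless_codes].

Definition containsb m :=
  has_lazily (fun mk => embedb (table_adj m) (size m) (table_adj mk.1) mk.2) tables.

Fixpoint for_bits k (p : seq bool -> bool) :=
  if k isn't k'.+1 then p [::] else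
  if for_bits k' (fun b => p (true :: b)) then for_bits k' (fun b => p (false :: b))
  else false.

Lemma for_bitsP k p b : for_bits k p -> size b = k -> p b.
Proof.
elim: b k p => [|[] b IH] [|k] p //=; case: ifP => // h h' [sb].
  exact: (IH k (fun b => p (true :: b)) h sb).
exact: (IH k (fun b => p (false :: b)) h' sb).
Qed.

(* Grows [m] by up to [f] vertices in all possible ways, until the hub is lost. *)
Fixpoint explore f m :=
  if hubb (table_adj m) (size m) then
    if f isn't f'.+1 then true
    else for_bits (size m) (fun b => explore f' (rcons m b))
  else containsb m.

Definition hub (G : sgraph) (S : pred G) := exists v, thin (@edge G) [predD1 S & v].

Section Explore.

Variables (G : sgraph) (x0 : G).

Definition table s := tabulate (fun i j => edge (nth x0 s i) (nth x0 s j)) (size s).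

Lemma size_table s : size (table s) = size s.
Proof. by rewrite size_mkseq. Qed.

(** In a lower triangular table a new last vertex adds one row and leaves the others alone, which
    matches the step of [explore]. *)
Lemma table_rcons s v :
  table (rcons s v) = rcons (table s) [seq edge v u | u <- s].
Proof.
rewrite /table /tabulate size_rcons /mkseq -addn1 iotaD map_cat add0n /= cats1.
congr rcons.
  apply/eq_in_map => i; rewrite mem_iota /= add0n => lt_i.
  apply/eq_in_map => j; rewrite mem_iota /= add0n => lt_j.
  by rewrite !nth_rcons lt_i (ltn_trans lt_j lt_i).
apply: (@eq_from_nth _ false) => [|i]; rewrite !size_map size_iota // => lt_i.
rewrite (nth_map 0) ?size_iota // (nth_map x0) // nth_iota // add0n.
by rewrite !nth_rcons ltnn eqxx lt_i.
Qed.

Lemma table_adjE s : {in iota 0 (size s) &, forall i j,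
  table_adj (table s) i j = edge (nth x0 s i) (nth x0 s j)}.
Proof.
by apply: table_adj_tabulate => i; [move=> j; apply: edge_sym | apply: edge_irr].
Qed.

Lemma hubb_hub s : uniq s -> hubb (table_adj (table s)) (size s) -> hub (mem s).
Proof.
move=> s_uniq /hasP[i]; rewrite mem_iota /= add0n => lt_i /thinbP h.
exists (nth x0 s i) => x y z.
have nthP u : [predD1 mem s & nth x0 s i] u ->
    exists j, [/\ j \in iota 0 (size s), j \in rem i (iota 0 (size s))
      & nth x0 s j = u].
  move=> /andP[ui us]; exists (index u s).
  rewrite mem_rem_uniq ?iota_uniq // inE mem_iota /= add0n index_mem us nth_index //.
  by split=> //; rewrite andbT; apply: contraNneq ui => <-; rewrite /= nth_index ?eqxx.
move=> /nthP[j [js ji <-]] /nthP[k [ks ki <-]] /nthP[l [ls li <-]].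
by rewrite -!table_adjE // => jk jl; congr (nth _ _ _); apply: h jk jl.
Qed.

Lemma containsb_embeds s : uniq s -> containsb (table s) ->
  exists2 k, k < size hubless_codes &
    @embeds_in (graph_of (nth P3 hubless_codes k)) G (mem s).
Proof.
move=> s_uniq; rewrite /containsb has_lazilyE has_map => /(has_nthP P3)[k lt_k /= h].
exists k => //; move: h; rewrite size_table.
apply: embedb_embeds_in => //; first exact: table_adjE.
apply: table_adj_tabulate; first exact: adj_sym.
by move=> i; rewrite /adj eqxx.
Qed.

(** The vertices of [t], added one at a time, single out a branch of the exploration. It ends either
    with [t] exhausted and a hub left, or at a prefix without a hub, which contains a listed
    graph. *)
Lemma exploreP f s t :
    explore f (table s) -> uniq (s ++ t) -> size t <= f ->
  hub (mem (s ++ t)) \/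
  exists2 k, k < size hubless_codes &
    @embeds_in (graph_of (nth P3 hubless_codes k)) G (mem (s ++ t)).
Proof.
have contained s' t' : containsb (table s') -> uniq (s' ++ t') ->
    exists2 k, k < size hubless_codes &
      @embeds_in (graph_of (nth P3 hubless_codes k)) G (mem (s' ++ t')).
  move=> /containsb_embeds h; rewrite cat_uniq => /andP[/h[k lt_k emb] _].
  by exists k => //; apply: embeds_in_sub emb => x xs; rewrite mem_cat xs.
elim: f s t => [|f IH] s t /=; rewrite size_table; case: ifP => [s_hub | _].
- by case: t => // _; rewrite cats0 => s_uniq _; left; apply: hubb_hub.
- by move=> h st_uniq _; right; apply: contained.
- case: t => [|v t] h; first by rewrite cats0 => s_uniq _; left; apply: hubb_hub.
  rewrite -cat_rcons; apply: IH; rewrite table_rcons.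
  exact: (for_bitsP (b := [seq edge v u | u <- s]) h (size_map _ _)).
by move=> h st_uniq _; right; apply: contained.
Qed.

End Explore.

(* Starting the enumeration from a cherry makes it about ten times shorter. *)
Definition cherry_table b : seq (seq bool) := [:: [::]; [:: true]; [:: true; b]].

(** Three further vertices bring the cherry to 6 vertices, the bound of [helly3]. *)
Lemma explore_cherry b : explore 3 (cherry_table b).
Proof. by case: b; vm_compute. Qed.

Lemma hubless_embeds6 (G : sgraph) (x y z : G) t :
    edge x y -> edge x z -> uniq [:: x, y, z & t] -> size t <= 3 ->
  ~ hub (mem [:: x, y, z & t]) ->
  exists2 k, k < size hubless_codes &
    @embeds_in (graph_of (nth P3 hubless_codes k)) G (mem [:: x, y, z & t]).
Proof.
move=> xy xz t_uniq t_size nhub.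
have h : explore 3 (table x [:: x; y; z]).
  (* With the centre [x] first, only the adjacency of [y] and [z] is left open. *)
  have -> : table x [:: x; y; z] = cherry_table (edge z y);
    last exact: explore_cherry.
  by rewrite /table /tabulate /mkseq /= ![edge _ x]edge_sym xy xz.
by case: (exploreP (t := t) h t_uniq t_size).
Qed.

(** * Cherries without a common vertex *)

Lemma card_bigcup_le (T I : finType) (A : {set I}) (F : I -> {set T}) n :
  (forall i, i \in A -> #|F i| <= n) -> #|\bigcup_(i in A) F i| <= #|A| * n.
Proof.
move=> Fn; rewrite -sum_nat_const.
elim/big_ind2: _ => [|k B l C Bk Cl|]; [by rewrite cards0 | | exact: Fn].
exact: leq_trans (leq_card_setU B C).1 (leq_add Bk Cl).
Qed.

(* Two disjoint members suffice. If there are none, either three members do, or each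
   chosen member has at most one point outside [f x0]. *)
Lemma helly3 (T : finType) (P : {set T} -> Prop) (S : {set T}) (x0 : T) :
    (forall A, P A -> #|A| = 3) ->
    (forall v, exists A, [/\ P A, A \subset S & v \notin A]) ->
  exists S' : {set T}, [/\ S' \subset S, #|S'| <= 6 &
    forall v, exists A, [/\ P A, A \subset S' & v \notin A]].
Proof.
move=> P3 /fin_all_exists[f]; move=> f_spec.
have fP v : P (f v) by case: (f_spec v).
have fS v : f v \subset S by case: (f_spec v).
have fN v : v \notin f v by case: (f_spec v).
have f3 v : #|f v| = 3 by apply/P3/fP.
have [/existsP[u /existsP[w dis]] | meet] :=
    boolP [exists u, exists w, [disjoint f u & f w]].
  exists (f u :|: f w); split; first by rewrite subUset !fS.
    by rewrite (leq_trans (leq_card_setU _ _).1) // !f3.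
  move=> v; have [vu|vu] := boolP (v \in f u); last by exists (f u); rewrite subsetUl.
  by exists (f w); rewrite subsetUr (disjointFr dis vu).
have {}meet u w : exists2 t, t \in f u & t \in f w.
  apply/exists_inP; apply: contraNT meet; rewrite negb_exists_in => /forall_inP h.
  apply/existsP; exists u; apply/existsP; exists w.
  by rewrite disjoint_subset; apply/subsetP => t /h.
have [/exists_inP[w wA /cards1P[t tE]] | two] :=
    boolP [exists w in f x0, #|f x0 :&: f w| == 1].
  have /andP[tA tw] : (t \in f x0) && (t \in f w) by rewrite -in_setI tE set11.
  (* The sets [f x0] and [f w] meet only in [t], which [f t] avoids. Hence [f t] meets them in two
     distinct points and adds at most one point to their 5. *)
  exists (f x0 :|: f w :|: f t); split; first by rewrite !subUset !fS.
    have cA : #|f x0 :|: f w| = 5 by rewrite cardsU tE cards1 !f3.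
    have cI : 2 <= #|(f x0 :|: f w) :&: f t|.
      have [a aA at_] := meet x0 t; have [b bw bt] := meet w t.
      apply/card_gt1P; exists a, b; rewrite !inE aA at_ bw bt orbT; split=> //.
      apply: contraNneq (fN t) => ab; rewrite -{1}(_ : a = t) //.
      by apply/set1P; rewrite -tE inE aA ab.
    by rewrite cardsU cA f3 leq_subLR (leq_trans _ (leq_add cI (leqnn _))).
  move=> v; have [vA|vA] := boolP (v \in f x0); last first.
    by exists (f x0); rewrite -setUA subsetUl.
  have [vw|vw] := boolP (v \in f w); last first.
    by exists (f w); split=> //; rewrite setUAC subsetUr.
  have -> : v = t by apply/set1P; rewrite -tE inE vA.
  by exists (f t); rewrite subsetUr.
(* Each [f w] with [w] in [f x0] now shares at least two points with [f x0], so the union has at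
   most 3 + 3 points. A vertex [v] is avoided by [f x0] if it lies outside [f x0], and by [f v]
   otherwise. *)
exists (f x0 :|: \bigcup_(w in f x0) (f w :\: f x0)); split.
- rewrite subUset fS; apply/bigcupsP => w _.
  exact: subset_trans (subsetDl _ _) (fS w).
- rewrite (leq_trans (leq_card_setU _ _).1) // f3 (leq_add2l 3 _ 3).
  rewrite (leq_trans (card_bigcup_le (n := 1) _)) ?f3 // => w wA.
  have : 0 < #|f x0 :&: f w|.
    by have [t tA tw] := meet x0 w; apply/card_gt0P; exists t; rewrite inE tA.
  have : #|f x0 :&: f w| != 1.
    by apply: contra two => h; apply/exists_inP; exists w.
  rewrite cardsD f3 setIC; case: #|_| => [|[|k]] // _ _.
  by rewrite !subSS leq_subr.
move=> v; have [vA|vA] := boolP (v \in f x0); last by exists (f x0); rewrite subsetUl.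
exists (f v); split=> //; apply/subsetP => t tv; rewrite inE.
have [//|tA] := boolP (t \in f x0).
by apply/bigcupP; exists v; rewrite // inE tA.
Qed.

Section Cherries.

Variable G : sgraph.
Implicit Types S C : pred G.

(** The centre is [x]; as [y] and [z] may be adjacent, triangles count. *)
Definition cherry S (x y z : G) :=
  [/\ [&& S x, S y & S z], edge x y, edge x z & y != z].

Lemma thinVcherry S : thin (@edge G) S \/ exists x y z, cherry S x y z.
Proof.
have [/thinbP h | /thinbPn[x [y [z [h xy xz yz]]]]] :=
    boolP (thinb (@edge G) (enum S)).
  by left; apply: thin_sub h => x; rewrite mem_enum.
by right; exists x, y, z; split=> //; move: h; rewrite !mem_enum.
Qed.

Lemma hub_dec S : hub S \/ ~ hub S.
Proof.
have [/existsP[v /thinbP h] | nh] :=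
    boolP [exists v, thinb (@edge G) (enum [predD1 S & v])].
  by left; exists v; apply: thin_sub h => x; rewrite mem_enum.
right=> -[v h]; move/negP: nh; apply; apply/existsP; exists v; apply/thinbP.
by apply: thin_sub h => x; rewrite mem_enum.
Qed.

Definition cherry_set (A : {set G}) :=
  exists x y z, A = [set x; y; z] /\ cherry predT x y z.

Lemma card_cherry_set A : cherry_set A -> #|A| = 3.
Proof.
move=> [x [y [z [-> [_ xy xz yz]]]]]; rewrite -setUA cardsU1 cards2 !inE negb_or yz.
by rewrite (edge_neq xy) (edge_neq xz).
Qed.

(** Deleting [v] destroys exactly the cherries through [v]. The right-hand side is the hypothesis of
    [helly3]. *)
Lemma hub_avoid S : ~ hub S <->
  forall v, exists A, [/\ cherry_set A, {subset A <= S} & v \notin A].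
Proof.
split=> [nh v | h [v hv]].
  have [hv | [x [y [z [/and3P[/andP[xv Sx] /andP[yv Sy] /andP[zv Sz]] xy xz yz]]]]] :=
      thinVcherry [predD1 S & v]; first by case: nh; exists v.
  exists [set x; y; z]; split; first by exists x, y, z.
    by move=> u; rewrite !inE => /orP[/orP[]|] /eqP ->.
  by rewrite !inE ![v == _]eq_sym !negb_or; apply/andP; split=> //; apply/andP.
have [A [[x [y [z [-> [_ xy xz yz]]]]] sub vA]] := h v.
have in_S u : u \in [set x; y; z] -> [predD1 S & v] u.
  move=> uA; apply/andP; split; last exact: sub.
  by apply: contraNneq vA => <-.
by move/eqP: yz; apply; apply: (hv x) => //; apply: in_S; rewrite !inE eqxx ?orbT.
Qed.

(** By [helly3], cherries without a common vertex already occur on at most 6 vertices, where the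
    exhaustive search applies. *)
Lemma hubless_embeds C : ~ hub C -> (exists x, C x) ->
  exists2 k, k < size hubless_codes &
    @embeds_in (graph_of (nth P3 hubless_codes k)) G C.
Proof.
move=> nhC [x0 _].
have [] := @helly3 G cherry_set [set x | C x] x0 card_cherry_set.
  move=> v; have [A [A_ch AC vA]] := (hub_avoid C).1 nhC v.
  by exists A; split=> //; apply/subsetP => u /AC; rewrite inE.
move=> S [SC S6 S_avoid].
have [A [[x [y [z [-> [_ xy xz yz]]]]] AS _]] := S_avoid x0.
(* A cherry is listed first, since the exploration starts from one. *)
pose t := [:: x, y, z & enum (S :\: [set x; y; z])].
have A_ch : cherry_set [set x; y; z] by exists x, y, z.
have tS : t =i S.
  move=> u; have := subsetP AS u; rewrite !inE mem_enum !inE.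
  by case: (u == x) => [-> //|]; case: (u == y) => [-> //|]; case: (u == z) => [-> //|].
have t_uniq : uniq t.
  rewrite /= !inE !mem_enum !inE !eqxx !orbT /= !orbF enum_uniq yz.
  by rewrite negb_or (edge_neq xy) (edge_neq xz).
have t_size : size (enum (S :\: [set x; y; z])) <= 3.
  by rewrite -cardE cardsD (setIidPr AS) (card_cherry_set A_ch) leq_subLR.
have [|k lt_k emb] := hubless_embeds6 xy xz t_uniq t_size.
  apply/hub_avoid => v; have [B [B_ch BS vB]] := S_avoid v.
  by exists B; split=> // u /(subsetP BS); rewrite -tS.
exists k => //; apply: embeds_in_sub emb => u; rewrite tS.
by move=> /(subsetP SC); rewrite inE.
Qed.

End Cherries.

(** * Sums of a hubless graph and a cherry *)

Lemma embeds_sum_code c d (G : sgraph) (C D : pred G) :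
    (forall x y, C x -> D y -> x != y /\ ~~ edge x y) ->
    @embeds_in (graph_of c) G C -> @embeds_in (graph_of d) G D ->
  embeds (graph_of (sum_code c d)) G.
Proof.
move=> CD [f [fI fE fC]] [g [gI gE gD]].
apply: embeds_trans (giso_embeds (giso_sym (giso_sum c d))) _.
exists (fun u : disjoint_union (graph_of c) (graph_of d) =>
  match u with inl x => f x | inr y => g y end); split=> //.
  move=> [x|x] [y|y] E; first by congr inl; apply: fI.
  - by have [] := CD _ _ (fC x) (gD y); rewrite E eqxx.
  - by have [] := CD _ _ (fC y) (gD x); rewrite E eqxx.
  - by congr inr; apply: gI.
move=> [x|x] [y|y] /=; rewrite ?fE ?gE //.
  by apply/negbTE; have [] := CD _ _ (fC x) (gD y).
by rewrite edge_sym; apply/negbTE; have [] := CD _ _ (fC y) (gD x).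
Qed.

Lemma cherry_embeds (G : sgraph) (D : pred G) x y z :
  cherry D x y z -> @embeds_in (graph_of (if edge y z then K3 else P3)) G D.
Proof.
move=> [/and3P[Dx Dy Dz] xy xz yz].
have yx : edge y x by rewrite edge_sym.
have c3 : (if edge y z then K3 else P3).1 = 3 by case: ifP.
(* The centre goes in the middle, as in [P3]. *)
apply: (@embeds_in_seq _ _ x [:: y; x; z]); rewrite ?c3 //.
  by move=> u; rewrite !inE => /or3P[] /eqP ->.
move=> [|[|[|i]]] [|[|[|j]]] //; rewrite ?ltnS ?ltn0 ?andbF //= => _;
  rewrite ?(edge_neq yx) ?(edge_neq xz) ?yx ?xz ?yz;
  by case: (edge y z).
Qed.

(** An absent weight gets index 28, which [F_embedsb] rejects. *)
Definition F_index c := index (code_weight c) F_weights.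

(* The weight of a graph isomorphic to one of [F_codes] reveals which one, which
   saves the search for an embedding from trying the other ones. *)
Definition F_embedsb c :=
  [&& 0 < c.1, F_index c < 28 &
      let d := nth (complete_code 0) F_codes (F_index c) in
      embedb (adj c) c.1 (adj d) d.1].

(** For [J_codes] these sums are themselves in [F_codes]. For the three graphs made of two cherries
    the components may come in another order, hence a search for an embedding. *)
Lemma F_codes_embed :
  all (fun J => F_embedsb (sum_code J P3) && F_embedsb (sum_code J K3)) hubless_codes.
Proof. by vm_compute. Qed.

Lemma F_embedsP c : F_embedsb c -> exists i : 'I_28, embeds (F_disc i) (graph_of c).
Proof.
move=> /and3P[c_gt0 lt_i emb].
exists (Ordinal lt_i); apply: embeds_trans (giso_embeds (F_disc_code _)) _.
pose s := enum (graph_of c); have s_size : size s = c.1 by rewrite size_enum_ord.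
rewrite -[in embedb _ _]s_size in emb.
apply: (@embeds_in_sub _ _ (mem s)) => //.
apply: (embedb_embeds_in (x0 := Ordinal c_gt0 : graph_of c) (enum_uniq _) _ _ emb) => //.
move=> k l; rewrite s_size !mem_iota /= !add0n => lt_k lt_l.
have nthE n : n < c.1 -> val (nth (Ordinal c_gt0) s n) = n by apply: nth_enum_ord.
by rewrite -{1}(nthE k lt_k) -{1}(nthE l lt_l).
Qed.

Lemma F_codes_nth (i : 'I_28) :
  let c := nth (complete_code 0) F_codes i in
  minimal_MT_obstruction (graph_of c) /\ disconnected (graph_of c).
Proof.
split; first exact/obstructionbP/(all_nthP _ F_codes_obstruction)/ltn_ord.
exact/disconnectedbP/(all_nthP _ F_codes_disconnected)/ltn_ord.
Qed.

Lemma F_disc_obstruction i : minimal_MT_obstruction (F_disc i).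
Proof. exact: minimal_MT_obstruction_giso (F_disc_code i) (F_codes_nth i).1. Qed.

Lemma F_disc_disconnected i : disconnected (F_disc i).
Proof. exact: disconnected_giso (F_disc_code i) (F_codes_nth i).2. Qed.

(** * Disconnected minimal obstructions *)

Definition closed_under_edges (G : sgraph) (C : pred G) :=
  forall x y : G, edge x y -> C x = C y.

(** Otherwise all of [C] could go to [B]: minimality partitions [G] minus [x0], hence the complement
    of [C], and no edge joins the two sides. *)
Lemma component_cherry (G : sgraph) (C : pred G) x0 :
    minimal_MT_obstruction G ->
  closed_under_edges C -> C x0 -> exists x y z, cherry C x y z.
Proof.
move=> G_min C_closed Cx0; have [thinC | //] := thinVcherry C; exfalso.
have [notMT /(_ x0) h] := (minimal_MT_obstructionP G).1 G_min; apply: notMT.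
have [a [hA hB]] : splits (@edge G) (predC C).
  by apply: splits_sub h => x; rewrite !inE; apply: contraNneq => ->.
exists (predD a C); split=> x y z.
  move=> /andP[_ /andP[Cx ax]] /andP[_ /andP[Cy ay]] /andP[_ /andP[Cz az]].
  by apply: hA; apply/andP.
move=> hx hy hz xy xz; have [Cx|Cx] := boolP (C x).
  by apply: (thinC x) => //; rewrite -(C_closed x).
have in_B u : C u = C x -> [predD predT & predD a C] u -> [predD predC C & a] u.
  move=> Cu /andP[/negP au _]; apply/andP; split; last by rewrite -topredE /= Cu.
  by apply/negP => hu; apply: au; apply/andP; rewrite Cu.
by apply: (hB x); rewrite // ?in_B // -?(C_closed x).
Qed.

Lemma not_both_hubs (G : sgraph) (C : pred G) :
    minimal_MT_obstruction G ->
  closed_under_edges C -> hub C -> hub (predC C) -> False.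
Proof.
move=> G_min C_closed [c hC] [d hD].
have [notMT _] := (minimal_MT_obstructionP G).1 G_min; apply: notMT.
(* The two hubs form [A]: among at most two vertices, each has at most one non-neighbour. An edge of
   the rest stays on one side, which has lost its hub. *)
exists (pred2 c d); split=> x y z.
  move=> /andP[_ hx] /andP[_ hy] /andP[_ hz] /andP[xy _] /andP[xz _].
  move: hx hy hz xy xz; rewrite !inE.
  by do 3![case/orP=> /eqP ->]; rewrite ?eqxx.
move=> /andP[hx _] /andP[hy _] /andP[hz _] xy xz.
move: hx hy hz; rewrite !inE !negb_or => /andP[xc xd] /andP[yc yd] /andP[zc zd].
have Cy := C_closed x y xy; have Cz := C_closed x z xz.
have [Cx|Cx] := boolP (C x).
  by apply: (hC x) => //; apply/andP; split=> //; rewrite -topredE /= -?Cy -?Cz.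
by apply: (hD x) => //; apply/andP; split=> //; rewrite -topredE /= -?Cy -?Cz.
Qed.

(** The hubless graph found in [C] and a cherry found outside [C] form a sum that contains a member
    of the family. This member is not Maya-Tupi, so the minimality of [G] makes its embedding an
    isomorphism. *)
Lemma hubless_component (G : sgraph) (C : pred G) :
    minimal_MT_obstruction G ->
    closed_under_edges C -> (exists x, C x) -> (exists y, ~~ C y) -> ~ hub C ->
  exists i : 'I_28, giso G (F_disc i).
Proof.
move=> G_min C_closed C_ex [y0 y0C] nhC; have [k lt_k emb] := hubless_embeds nhC C_ex.
have [|x [y [z xyz]]] := @component_cherry G (predC C) y0 G_min _ y0C.
  by move=> u v uv; rewrite /= (C_closed u v uv).
have := embeds_sum_code _ emb (cherry_embeds xyz).
have /andP[/F_embedsP[i i_emb] /F_embedsP[j j_emb]] := (all_nthP P3 F_codes_embed) k lt_k.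
have F_nMT l : ~ maya_tupi (F_disc l) by case: (F_disc_obstruction l).
have CD u v : C u -> predC C v -> u != v /\ ~~ edge u v.
  move=> Cu Cv; split; first by apply: contraNneq Cv => <-.
  by apply: contraNN Cv => /C_closed <-.
case: (edge y z) => /(_ CD) sum_emb.
  by exists j; apply: embeds_minimal_giso (embeds_trans j_emb sum_emb).
by exists i; apply: embeds_minimal_giso (embeds_trans i_emb sum_emb).
Qed.

Theorem theorem4p3 :
  (forall i j : 'I_28, giso (F_disc i) (F_disc j) -> i = j) /\
  (forall G : sgraph,
     disconnected G /\ minimal_MT_obstruction G <->
     exists i : 'I_28, giso G (F_disc i)).
Proof.
split; first exact: F_disc_inj.
move=> G; split=> [[/disconnectedP[C [C_closed Cxy]] G_min] | [i G_iso]]; last first.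
  split; first exact: disconnected_giso G_iso (F_disc_disconnected i).
  exact: minimal_MT_obstruction_giso G_iso (F_disc_obstruction i).
(* If [C] has a hub then its complement has none, so one of the two sides is hubless. *)
have [x [y [Cx Cy]]] := Cxy; have [hubC | nhubC] := hub_dec C; last first.
  by apply: (hubless_component G_min C_closed) => //; [exists x | exists y].
have C'_closed : closed_under_edges (predC C) by move=> u v /C_closed /= ->.
apply: (hubless_component G_min C'_closed); [by exists y | by exists x; rewrite /= Cx |].
by move=> /(not_both_hubs G_min C_closed hubC).
Qed.
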